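(* Let $P(\lambda)$ be a regular $n\times n$ complex matrix polynomial, $\Gamma$ a given closed contour in the complex plane on which no eigenvalue of $P(\lambda)$ lies, $u\in\mathbb{C}^n$ an arbitrary vector and $v\in\mathbb{C}^n$ a nonzero vector. Let $\lambda_1,\ldots,\lambda_m$ be all the eigenvalues of $P(\lambda)$ in the interior of $\Gamma$. Let $(\lambda_i,w_i)$, $i=1,\ldots,m$, be eigenpairs for the matrix pencil $H_1-\lambda H_0$, where the eigenvalues $\lambda_i$, which belong to the interior of $\Gamma$, are simple, distinct and nondegenerate. Let $S=[s_0,s_1,\ldots,s_{m-1}]$ and $C=H_0^{-1}H_1$. Then the pair $(S,C)$ satisfies $P(S,C)=0$, i.e., $(S,C)$ is a simple invariant pair for $P(\lambda)$.
   Context: $P(\lambda)=\sum_{j=0}^\ell A_j\lambda^j$, with $A_j\in\mathbb{C}^{n\times n}$ and $A_\ell\ne0$, is regular if $\det P(\lambda)$ does not vanish identically. The algebraic multiplicity of an eigenvalue of $P(\lambda)$ is its multiplicity as a root of $\det P(\lambda)$; its geometric multiplicity is the dimension of the null space of $P$ evaluated at it. An eigenvalue is simple if its algebraic multiplicity is one and nondegenerate if its geometric multiplicity is one. Define $$\mu_k=\frac{1}{2\pi\imath}\oint_\Gamma z^k\,u^HP(z)^{-1}v\,dz,\qquad s_k=\frac{1}{2\pi\imath}\oint_\Gamma z^kP(z)^{-1}v\,dz\in\mathbb{C}^n,\qquad k=0,1,\ldots,$$ and the $m\times m$ Hankel matrices $H_0=[\mu_{i+j}]_{i,j=0}^{m-1}$,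 $H_1=[\mu_{i+j+1}]_{i,j=0}^{m-1}$. For $(X,T)\in\mathbb{C}^{n\times k}\times\mathbb{C}^{k\times k}$ put $P(X,T):=\sum_{j=0}^\ell A_jXT^j$. The pair $(X,T)$, with $X\neq0$ and $1\le k\le\ell n$, is an invariant pair for $P(\lambda)$ if $P(X,T)=0$. It is minimal if for some $r\in\mathbb{N}$ the matrix obtained by stacking $XT^{r-1},\ldots,XT,X$ vertically has full column rank. An invariant pair is simple if it is minimal and the algebraic multiplicities of the eigenvalues of $T$ are identical to those of the corresponding eigenvalues of $P(\lambda)$. *)

(* Defs.v *)
From HB Require Import structures.
From mathcomp Require Import all_boot all_order all_algebra.
From mathcomp Require Import all_classical all_reals all_analysis.
From mathcomp Require Export complex.
Set Implicit Arguments.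
Unset Strict Implicit.
Unset Printing Implicit Defensive.
Import Order.TTheory GRing.Theory Num.Theory.
Import numFieldTopology.Exports numFieldNormedType.Exports.
Local Open Scope classical_set_scope.
Local Open Scope ring_scope.
Local Open Scope complex_scope.

(** Matrix polynomials [P(z) = \sum_(j <= l) z ^+ j *: A j] are given by their
    coefficient family [A : 'I_l.+1 -> 'M[F]_n]. *)
Section MatrixPolynomial.
Variables (F : fieldType) (n l : nat).
Implicit Types (A : 'I_l.+1 -> 'M[F]_n) (z : F).

Definition mpeval A z : 'M[F]_n := \sum_(j < l.+1) z ^+ j *: A j.

Definition mpdet A : {poly F} :=
  \det (\sum_(j < l.+1) 'X^j *: map_mx polyC (A j)).

Definition mpregular A := mpdet A != 0.

Definition mpeigenpair A z (x : 'cV[F]_n) := x != 0 /\ mpeval A z *m x = 0.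

Definition mpeigenvalue A z := exists x, mpeigenpair A z x.

Definition alg_mult A z : nat := mup z (mpdet A).

(** The column space of [cokermx M] is the null space [{x | M *m x = 0}]. *)
Definition geom_mult A z : nat := \rank (cokermx (mpeval A z)).

(** [mup z 0 = 0], so a simple eigenvalue forces [mpdet A != 0]. *)
Definition simple_eigenvalue A z := mpeigenvalue A z /\ alg_mult A z = 1%N.

Definition nondegenerate_eigenvalue A z :=
  mpeigenvalue A z /\ geom_mult A z = 1%N.

Section InvariantPair.
Variables (A : 'I_l.+1 -> 'M[F]_n) (k : nat) (X : 'M[F]_(n, k)) (T : 'M[F]_k).

Definition mppair : 'M[F]_(n, k) := \sum_(j < l.+1) A j *m X *m T ^+ j.

Definition invariant_pair :=
  [/\ X != 0, (1 <= k <= l * n)%N & mppair = 0].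

Definition minimal_pair := exists r : nat,
  \rank (\mxcol_(i < r) (X *m T ^+ (r.-1 - i))) = k.

Definition simple_invariant_pair :=
  [/\ invariant_pair, minimal_pair &
      forall z, eigenvalue T z -> mup z (char_poly T) = alg_mult A z].

End InvariantPair.
End MatrixPolynomial.

(** The pencil [H1 - z H0] as a matrix polynomial with two coefficients. *)
Definition pencil (F : fieldType) m (H1 H0 : 'M[F]_m) : 'I_2 -> 'M[F]_m :=
  fun j => if j == ord0 then H1 else - H0.

Section Contour.
Variable R : realType.
Implicit Types (a b : R) (g : R -> R[i]).

Definition C1_on a b (f : R -> R) := exists2 df : R -> R,
  {within `[a, b], continuous df} &
  forall t, a < t < b -> is_derive t (1 : R) f (df t).

(** A closed contour: a continuous, piecewise continuously differentiable
    closed path parametrized by [`[a, b]]; [s] lists the break points.  Neither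
    simplicity nor an orientation is imposed. *)
Definition closed_contour a b g :=
  [/\ a < b, g a = g b,
      {within `[a, b], continuous (fun t => complex.Re (g t))},
      {within `[a, b], continuous (fun t => complex.Im (g t))} &
      exists s : seq R,
        [/\ path <%R a s, last a s = b &
            forall i, (i < size s)%N ->
              C1_on (nth a (a :: s) i) (nth a s i) (fun t => complex.Re (g t)) /\
              C1_on (nth a (a :: s) i) (nth a s i) (fun t => complex.Im (g t))]].

Definition trace a b g : set R[i]^o := [set g t | t in `[a, b]].

(** The union of the bounded connected components of the complement of the
    trace; for a Jordan curve, its inside. *)
Definition contour_interior a b g : set R[i]^o :=
  [set z | ~ trace a b g z /\
           bounded_set (connected_component (~` trace a b g) z)].

(** The values of the derivative at the finitely many break points do not
    affect the integral. *)
Definition cderive g (t : R) : R[i] :=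
  derive1 (fun x => complex.Re (g x)) t +i* derive1 (fun x => complex.Im (g x)) t.

Definition cintegral a b g : R[i] :=
  (\int[lebesgue_measure]_(t in `[a, b]) complex.Re (g t)) +i*
  (\int[lebesgue_measure]_(t in `[a, b]) complex.Im (g t)).

Definition contour_integral a b g (f : R[i] -> R[i]) : R[i] :=
  cintegral a b (fun t => f (g t) * cderive g t).

Definition twopii : R[i] := 0 +i* (2 * pi).

Section Moments.
Variables (a b : R) (g : R -> R[i]) (n l : nat) (A : 'I_l.+1 -> 'M[R[i]]_n).
Variables (u v : 'cV[R[i]]_n).

Definition mu_moment (k : nat) : R[i] :=
  twopii^-1 * contour_integral a b g
    (fun z => z ^+ k *
       ((map_mx conjc u)^T *m invmx (mpeval A z) *m v) ord0 ord0).

Definition s_moment (k : nat) : 'cV[R[i]]_n :=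
  \col_i (twopii^-1 * contour_integral a b g
    (fun z => z ^+ k * (invmx (mpeval A z) *m v) i ord0)).

(** [hankel 0] and [hankel 1] are the Hankel matrices [H_0] and [H_1]. *)
Definition hankel (d m : nat) : 'M[R[i]]_m :=
  \matrix_(i, j) mu_moment (i + j + d).

Definition smatrix (m : nat) : 'M[R[i]]_(n, m) :=
  \matrix_(i, j) s_moment j i ord0.

End Moments.
End Contour.

(* Main.v *)
Require Import Defs.
From mathcomp Require Import all_boot all_order all_algebra.
From mathcomp Require Import all_classical all_reals all_analysis.
From mathcomp Require Import measurable_realfun.
From mathcomp Require Import ring lra.
Set Implicit Arguments.
Unset Strict Implicit.
Unset Printing Implicit Defensive.
Import Order.TTheory GRing.Theory Num.Theory.
Import numFieldTopology.Exports numFieldNormedType.Exports.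
Local Open Scope classical_set_scope.
Local Open Scope ring_scope.
Local Open Scope complex_scope.

(** Write d(z) = det P(z) and P(z)^-1 v = N(z) / d(z), where N is the adjugate
    of P applied to v, a vector of polynomials. The eigenvalues lam_1 .. lam_m
    inside the contour are simple roots of d, and the contour does not wind
    around any other root, so the residue theorem expresses every moment as

      s_k = sum_i x_i lam_i^k,   mu_k = sum_i delta_i lam_i^k,

    where x_i is the residue N(lam_i) / d'(lam_i) times the winding number about
    lam_i, and delta_i = u^H x_i. The vector x_i lies in the null space of
    P(lam_i), because P N = d v. In matrix form, with V the Vandermonde matrix
    (row k holds the powers lam_i^k), L = diag(lam) and D = diag(delta),

      S = X V^T,   H_0 = V D V^T,   H_1 = V D L V^T.

    Since the lam_i are simple eigenvalues of the pencil, det (H_1 - z H_0) is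
    not identically zero, so D is invertible; V is invertible because the lam_i
    are distinct. Hence C = V^-T L V^T, so that (S, C) is (X, L) in another
    basis. The pair (X, L) is invariant because P(lam_i) x_i = 0; it is minimal
    because the lam_i are distinct and no x_i vanishes (delta_i is nonzero); and
    each lam_i has multiplicity one both in the characteristic polynomial of L
    and in d. The winding numbers are absorbed into the x_i, so the
    contour may have either orientation and may cross itself.

    The analytic part is [residue_formula]. The contour is only piecewise
    continuously differentiable, so integrals are computed piece by piece with
    the fundamental theorem of calculus ([pw_FTC]); any function with a
    primitive along the trace integrates to 0 ([contour_integral_primitive]),
    which covers polynomials and poles of order at least two. The integral of
    1 / (y - z) is locally constant in z off the trace, by a geometric expansion
    whose terms other than the first integrate to 0 ([pole_integral_near]), and
    it vanishes for large z for the same reason ([pole_integral_far]); it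
    therefore vanishes on every unbounded component of the complement
    ([pole_integral_outside]). Partial fractions then reduce a rational function
    to these cases ([partial_fractions], [contour_integral_frac0]).

    The algebraic part consists of [mppair_diag], [char_poly_diag],
    [minimal_pair_diag] and [pencil_diag_neq0]. *)

(** * Piecewise continuous functions *)

Section Piecewise.
Variable R : realType.
Implicit Types (a b x y t : R) (s : seq R) (f h k F : R -> R).
Local Notation mu := (@lebesgue_measure R).

(** Consuming the break points from the left lets every statement about a
    subdivided interval go by induction on the list. *)
Fixpoint on_pieces (P : R -> R -> Prop) a s : Prop :=
  if s is c :: s' then P a c /\ on_pieces P c s' else True.

Lemma on_pieces_nth P a s :
  (forall i, (i < size s)%N -> P (nth a (a :: s) i) (nth a s i)) ->
  on_pieces P a s.
Proof.
elim: s a => [|c s IH] a //= H; split; first exact: (H 0%N).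
apply: IH => i si.
rewrite (set_nth_default a) ?(set_nth_default a c si) //; last by rewrite /= ltnW.
exact: (H i.+1).
Qed.

Lemma path_le_last a s : path <%R a s -> a <= last a s.
Proof. by elim: s a => //= c s IH a /andP[/ltW ac /IH]; apply: le_trans. Qed.

(** Keeping the bounds of the piece allows facts about the whole interval to be
    used on it. *)
Lemma on_pieces_imp (P Q : R -> R -> Prop) a s : path <%R a s ->
  (forall x y, a <= x -> x < y -> y <= last a s -> P x y -> Q x y) ->
  on_pieces P a s -> on_pieces Q a s.
Proof.
move=> ps PQ.
elim: s a ps PQ => [|c s IH] a //= /andP[ac ps] PQ [Pac Pcs].
split; first by apply: PQ => //; exact: path_le_last.
by apply: IH => // x y cx; apply: PQ; rewrite (le_trans _ cx) ?ltW.
Qed.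

(** Only the open pieces count: at a break point the derivative of the path has
    an unspecified value. *)
Definition pw_continuous h a s := on_pieces (fun x y => exists2 k,
  {within `[x, y], continuous k} & forall t, x < t < y -> h t = k t) a s.

Lemma piece_integrable x y h k : {within `[x, y], continuous k} ->
  (forall t, x < t < y -> h t = k t) -> mu.-integrable `[x, y] (EFin \o h).
Proof.
move=> ck hk.
have ik : mu.-integrable `[x, y] (EFin \o k).
  by apply: continuous_compact_integrable => //; exact: segment_compact.
have sub : `]x, y[ `<=` `[x, y].
  by move=> t /=; rewrite !in_itv /= => /andP[/ltW -> /ltW ->].
have io : mu.-integrable `]x, y[ (EFin \o h).
  have := @eq_integrable _ _ R mu `]x, y[ (measurable_itv _) (EFin \o k) (EFin \o h).
  apply; [|exact: integrableS ik].
  by move=> t /set_mem /=; rewrite in_itv /= => /hk ->.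
have /integrableP[mio fin] := io.
apply/integrableP; split; first exact: emeasurable_fun_itv_cc mio.
rewrite integral_itv_bndoo//.
exact: measurableT_comp.
Qed.

Lemma integrable_itv_cat x y z h : x <= y -> y <= z ->
  mu.-integrable `[x, y] (EFin \o h) -> mu.-integrable `[y, z] (EFin \o h) ->
  mu.-integrable `[x, z] (EFin \o h).
Proof.
move=> xy yz ixy iyz.
have E : `[x, z]%classic = `[x, y] `|` `]y, z].
  by rewrite -itv_bndbnd_setU ?bnd_simp //.
have /integrableP[m2 f2] : mu.-integrable `]y, z] (EFin \o h).
  by apply: integrableS iyz => //; apply: subset_itvr; rewrite bnd_simp.
have /integrableP[m1 f1] := ixy.
have mU : measurable_fun (`[x, y] `|` `]y, z]) (EFin \o h).
  exact/measurable_funU.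
rewrite E; apply/integrableP; split => //.
rewrite ge0_integral_setU //.
- by rewrite lte_add_pinfty.
- exact: measurableT_comp.
- apply/disj_setPS => t [/=]; rewrite 2!in_itv/= => /andP[_ ty] /andP[].
  by rewrite ltNge ty.
Qed.

Lemma Rintegral_itv_cat x y z h : x <= y -> y <= z ->
  mu.-integrable `[x, y] (EFin \o h) -> mu.-integrable `[y, z] (EFin \o h) ->
  \int[mu]_(t in `[x, z]) h t =
  \int[mu]_(t in `[x, y]) h t + \int[mu]_(t in `[y, z]) h t.
Proof.
move=> xy yz ixy iyz.
have := Rintegral_itvB (integrable_itv_cat xy yz ixy iyz) (_ : BLeft x <= BRight y)%O
  (_ : BRight y <= BRight z)%O.
rewrite !bnd_simp => /(_ xy yz) E.
rewrite -(@Rintegral_itv_obnd_cbnd _ y).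
  by rewrite -E addrC subrK.
by apply: integrableS iyz => //; apply: subset_itvr; rewrite bnd_simp.
Qed.

Lemma pw_continuous_integrable h a s : path <%R a s -> pw_continuous h a s ->
  mu.-integrable `[a, last a s] (EFin \o h).
Proof.
elim: s a => [|c s IH] a /=.
  move=> _ _; apply: (@piece_integrable a a h (cst (h a))).
    by apply: continuous_subspaceT => ?; exact: cvg_cst.
  by move=> t /andP[/lt_trans H/H]; rewrite ltxx.
move=> /andP[ac ps] [[k ck hk] hs].
apply: (@integrable_itv_cat _ c).
- exact: ltW.
- exact: path_le_last.
- exact: piece_integrable ck hk.
- exact: IH.
Qed.

(** On each piece the continuous representative of h has F as a primitive; the
    contributions telescope because F is continuous at the break points. *)
Lemma pw_FTC h F a s : path <%R a s -> pw_continuous h a s ->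
  {within `[a, last a s], continuous F} ->
  on_pieces (fun x y => forall t, x < t < y -> is_derive t (1 : R) F (h t)) a s ->
  \int[mu]_(t in `[a, last a s]) h t = F (last a s) - F a.
Proof.
elim: s a => [|c s IH] a /=.
  by rewrite set_itv1 Rintegral_set1 subrr.
move=> /andP[ac ps] [[k ck hk] hs] cF [dF dFs].
have cl := path_le_last ps.
rewrite (@Rintegral_itv_cat _ c) //; [|exact: ltW|exact: piece_integrable ck hk
  |exact: pw_continuous_integrable].
have cF1 : {within `[a, c], continuous F}.
  by apply: continuous_subspaceW cF; apply: subset_itvl; rewrite bnd_simp.
have cF2 : {within `[c, last c s], continuous F}.
  by apply: continuous_subspaceW cF; apply: subset_itvr; rewrite bnd_simp ltW.
suff E1 : \int[mu]_(t in `[a, c]) h t = F c - F a.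
  by rewrite IH // E1 addrC addrA subrK.
have [fi _] := continuous_within_itvP F ac.
have {fi}[_ Fa Fc] := fi cF1.
have -> : \int[mu]_(t in `[a, c]) h t = \int[mu]_(t in `[a, c]) k t.
  congr fine; apply: eq_integral_itv_bounded.
  - have /integrableP[/measurable_EFinP m _] := piece_integrable ck hk.
    by apply: measurable_funS m => // t /=; rewrite !in_itv /= => /andP[/ltW -> /ltW ->].
  - have /integrableP[/measurable_EFinP m _] := piece_integrable ck (fun t _ => erefl (k t)).
    by apply: measurable_funS m => // t /=; rewrite !in_itv /= => /andP[/ltW -> /ltW ->].
  - by move=> t; rewrite in_itv /= => /hk.
rewrite /Rintegral (@continuous_FTC2 _ k F) //.
- split => //; move=> t; rewrite in_itv /= => /dF d; exact: ex_derive.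
- by move=> t; rewrite in_itv /= => tac; rewrite derive1E; have d := dF _ tac;
    rewrite derive_val hk.
Qed.

Lemma pw_continuousN h a s : pw_continuous h a s -> pw_continuous (- h) a s.
Proof.
elim: s a => //= c s IH a [[k ck hk] hs]; split; last exact: IH.
exists (- k); first by move=> t; apply: continuousN; exact: ck.
by move=> t /hk; rewrite !fctE => ->.
Qed.

Lemma pw_continuousD h1 h2 a s : pw_continuous h1 a s -> pw_continuous h2 a s ->
  pw_continuous (h1 + h2) a s.
Proof.
elim: s a => //= c s IH a [[k ck hk] hs] [[k' ck' hk'] hs']; split; last exact: IH.
exists (k + k').
  by move=> t; apply: continuousD; [exact: ck|exact: ck'].
by move=> t tac; rewrite !fctE hk ?hk'.
Qed.

Lemma pw_continuousM k h a s : path <%R a s ->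
  {within `[a, last a s], continuous k} -> pw_continuous h a s ->
  pw_continuous (k * h) a s.
Proof.
move=> ps ck; apply: on_pieces_imp => // x y ax xy yl [h' ch' hh'].
exists (k * h'); last by move=> t txy; rewrite !fctE hh'.
have ck' : {within `[x, y], continuous k}.
  by apply: continuous_subspaceW ck; apply: subset_itv; rewrite bnd_simp.
by move=> t; apply: continuousM; [exact: ck'|exact: ch'].
Qed.

End Piecewise.

(** * Complex-valued functions of a real variable *)

Section ComplexCalculus.
Variable R : realType.
Implicit Types (h : R -> R[i]) (F f : R[i] -> R[i]) (X : set R) (z c d : R[i]).

Definition re h t : R := complex.Re (h t).
Definition im h t : R := complex.Im (h t).

Lemma complex_ReM z c : complex.Re (z * c) =
  complex.Re z * complex.Re c - complex.Im z * complex.Im c.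
Proof. by case: z c => [? ?] []. Qed.

Lemma complex_ImM z c : complex.Im (z * c) =
  complex.Re z * complex.Im c + complex.Im z * complex.Re c.
Proof. by case: z c => [? ?] []. Qed.

Lemma complex_ReD z c : complex.Re (z + c) = complex.Re z + complex.Re c.
Proof. by case: z c => [? ?] []. Qed.

Lemma complex_ImD z c : complex.Im (z + c) = complex.Im z + complex.Im c.
Proof. by case: z c => [? ?] []. Qed.

Lemma complex_ReV z : complex.Re z^-1 =
  complex.Re z * (complex.Re z ^+ 2 + complex.Im z ^+ 2)^-1.
Proof. by case: z. Qed.

Lemma complex_ImV z : complex.Im z^-1 =
  - (complex.Im z * (complex.Re z ^+ 2 + complex.Im z ^+ 2)^-1).
Proof. by case: z. Qed.

Lemma sqnormc_neq0 z : z != 0 -> complex.Re z ^+ 2 + complex.Im z ^+ 2 != 0.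
Proof.
apply: contra; rewrite paddr_eq0 ?sqr_ge0 // !sqrf_eq0.
by case: z => x y /= /andP[/eqP-> /eqP->].
Qed.

Definition ccont X h :=
  {within X, continuous (re h)} /\ {within X, continuous (im h)}.

Lemma ccont_cst X c : ccont X (fun=> c).
Proof. by split=> t; exact: cvg_cst. Qed.

Lemma ccontD X h1 h2 : ccont X h1 -> ccont X h2 -> ccont X (fun t => h1 t + h2 t).
Proof.
move=> [cr1 ci1] [cr2 ci2]; split.
- rewrite (_ : re _ = re h1 + re h2); last by apply/funext => t; exact: complex_ReD.
  by move=> t; apply: continuousD; [exact: cr1|exact: cr2].
- rewrite (_ : im _ = im h1 + im h2); last by apply/funext => t; exact: complex_ImD.
  by move=> t; apply: continuousD; [exact: ci1|exact: ci2].
Qed.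

Lemma ccontM X h1 h2 : ccont X h1 -> ccont X h2 -> ccont X (fun t => h1 t * h2 t).
Proof.
move=> [cr1 ci1] [cr2 ci2]; split.
- rewrite (_ : re _ = re h1 * re h2 - im h1 * im h2); last first.
    by apply/funext => t; exact: complex_ReM.
  by move=> t; apply: continuousB; apply: continuousM;
    [exact: cr1|exact: cr2|exact: ci1|exact: ci2].
- rewrite (_ : im _ = re h1 * im h2 + im h1 * re h2); last first.
    by apply/funext => t; exact: complex_ImM.
  by move=> t; apply: continuousD; apply: continuousM;
    [exact: cr1|exact: ci2|exact: ci1|exact: cr2].
Qed.

Lemma ccontX X h n : ccont X h -> ccont X (fun t => h t ^+ n).
Proof.
move=> ch; elim: n => [|n IH]; first exact: ccont_cst.
by under eq_fun do rewrite exprS; exact: ccontM.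
Qed.

Lemma ccont_horner X h (p : {poly R[i]}) : ccont X h -> ccont X (fun t => p.[h t]).
Proof.
move=> ch; elim/poly_ind: p => [|p c IH].
  by under eq_fun do rewrite horner0; exact: ccont_cst.
under eq_fun do rewrite hornerMXaddC.
by apply: ccontD; [exact: ccontM|exact: ccont_cst].
Qed.

Lemma ccont_sqnorm X h : ccont X h ->
  {within X, continuous (fun t => re h t ^+ 2 + im h t ^+ 2)}.
Proof.
move=> [cr ci].
rewrite (_ : (fun=> _) = re h * re h + im h * im h); last first.
  by apply/funext => t; rewrite !expr2.
by move=> t; apply: continuousD; apply: continuousM;
  [exact: cr|exact: cr|exact: ci|exact: ci].
Qed.

Lemma continuous_within_inv X (f : R -> R) : (forall t, X t -> f t != 0) ->
  {within X, continuous f} -> {within X, continuous (fun t => (f t)^-1)}.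
Proof.
move=> f0 /subspace_continuousP cf; apply/subspace_continuousP => t Xt.
by apply: cvgV; [exact: f0|exact: cf].
Qed.

Lemma ccontV X h : (forall t, X t -> h t != 0) -> ccont X h ->
  ccont X (fun t => (h t)^-1).
Proof.
move=> h0 ch; have [cr ci] := ch.
have cn : {within X, continuous (fun t => (re h t ^+ 2 + im h t ^+ 2)^-1)}.
  apply: continuous_within_inv (ccont_sqnorm ch).
  by move=> t /h0; exact: sqnormc_neq0.
split.
- rewrite (_ : re _ = re h * (fun t => (re h t ^+ 2 + im h t ^+ 2)^-1)).
    by move=> t; apply: continuousM; [exact: cr|exact: cn].
  by apply/funext => t; exact: complex_ReV.
- rewrite (_ : im _ = - (im h * (fun t => (re h t ^+ 2 + im h t ^+ 2)^-1))).
    by move=> t; apply: continuousN; apply: continuousM; [exact: ci|exact: cn].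
  by apply/funext => t; exact: complex_ImV.
Qed.

Definition path_derive h (t : R) d :=
  is_derive t (1 : R) (re h) (complex.Re d) /\
  is_derive t (1 : R) (im h) (complex.Im d).

(** Complex differentiability of F at z with derivative f z, expressed by the
    chain rule along differentiable paths through z: this is the form in which
    the fundamental theorem of calculus applies to a contour integral. *)
Definition primitive_at F f z := forall h t d, h t = z ->
  path_derive h t d -> path_derive (fun s => F (h s)) t (f z * d).

Lemma path_derive_cst c t : path_derive (fun=> c) t 0.
Proof. by split; exact: is_derive_cst. Qed.

Lemma path_deriveD h1 h2 t d1 d2 : path_derive h1 t d1 -> path_derive h2 t d2 ->
  path_derive (fun s => h1 s + h2 s) t (d1 + d2).
Proof.
move=> [r1 i1] [r2 i2]; split.
- rewrite (_ : re _ = re h1 + re h2); last by apply/funext => s; exact: complex_ReD.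
  by rewrite complex_ReD; exact: is_deriveD.
- rewrite (_ : im _ = im h1 + im h2); last by apply/funext => s; exact: complex_ImD.
  by rewrite complex_ImD; exact: is_deriveD.
Qed.

Lemma path_deriveM h1 h2 t d1 d2 : path_derive h1 t d1 -> path_derive h2 t d2 ->
  path_derive (fun s => h1 s * h2 s) t (h1 t * d2 + h2 t * d1).
Proof.
move=> [r1 i1] [r2 i2]; split.
- rewrite (_ : re _ = re h1 * re h2 - im h1 * im h2); last first.
    by apply/funext => s; exact: complex_ReM.
  apply: is_derive_eq; rewrite /GRing.scale /= complex_ReD !complex_ReM /re /im; ring.
- rewrite (_ : im _ = re h1 * im h2 + im h1 * re h2); last first.
    by apply/funext => s; exact: complex_ImM.
  apply: is_derive_eq; rewrite /GRing.scale /= complex_ImD !complex_ImM /re /im; ring.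
Qed.

Lemma path_deriveV h t d : h t != 0 -> path_derive h t d ->
  path_derive (fun s => (h s)^-1) t (- (h t) ^- 2 * d).
Proof.
move=> h0 [r i].
have n0 : re h t ^+ 2 + im h t ^+ 2 != 0 by exact: sqnormc_neq0.
have dn : is_derive t (1 : R) (re h ^+ 2 + im h ^+ 2)
    (2 * re h t * complex.Re d + 2 * im h t * complex.Im d).
  by apply: is_derive_eq; rewrite /GRing.scale /=; ring.
have dV := @is_deriveV _ (re h ^+ 2 + im h ^+ 2) t _ 1 n0 dn.
have E (x y : R) : (x * x - y * y) ^+ 2 + (x * y + y * x) ^+ 2 = (x ^+ 2 + y ^+ 2) ^+ 2.
  by ring.
split.
- rewrite (_ : re _ = re h * (fun s => ((re h ^+ 2 + im h ^+ 2) s)^-1)); last first.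
    by apply/funext => s; exact: complex_ReV.
  apply: is_derive_eq; clear r i dn dV; move: n0.
  rewrite /GRing.scale /= !fctE /= mulNr /re /im -exprVn.
  by move: (h t) d => [x y] [x' y'] /= n0; rewrite E; field.
- rewrite (_ : im _ = - (im h * (fun s => ((re h ^+ 2 + im h ^+ 2) s)^-1))); last first.
    by apply/funext => s; exact: complex_ImV.
  apply: is_derive_eq; clear r i dn dV; move: n0.
  rewrite /GRing.scale /= !fctE /= mulNr /re /im -exprVn.
  by move: (h t) d => [x y] [x' y'] /= n0; rewrite E; field.
Qed.

Lemma primitive_at_cst c z : primitive_at (fun=> c) (fun=> 0) z.
Proof. by move=> h t d _ _; rewrite mul0r; exact: path_derive_cst. Qed.

Lemma primitive_at_id z : primitive_at id (fun=> 1) z.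
Proof. by move=> h t d _; rewrite mul1r. Qed.

Lemma primitive_atD F1 F2 f1 f2 z : primitive_at F1 f1 z -> primitive_at F2 f2 z ->
  primitive_at (fun y => F1 y + F2 y) (fun y => f1 y + f2 y) z.
Proof.
move=> d1 d2 h t d hz hd; rewrite mulrDl.
by apply: path_deriveD; [exact: d1|exact: d2].
Qed.

Lemma primitive_atM F1 F2 f1 f2 z : primitive_at F1 f1 z -> primitive_at F2 f2 z ->
  primitive_at (fun y => F1 y * F2 y) (fun y => F1 y * f2 y + F2 y * f1 y) z.
Proof.
move=> d1 d2 h t d hz hd; rewrite mulrDl -!mulrA -hz.
by apply: path_deriveM; rewrite hz; [exact: d1|exact: d2].
Qed.

Lemma primitive_atV F f z : F z != 0 -> primitive_at F f z ->
  primitive_at (fun y => (F y)^-1) (fun y => - (F y) ^- 2 * f y) z.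
Proof.
move=> F0 d1 h t d hz hd; rewrite -mulrA -hz.
by apply: path_deriveV; rewrite hz //; exact: d1.
Qed.

Lemma primitive_atX F f n z : primitive_at F f z ->
  primitive_at (fun y => F y ^+ n) (fun y => n%:R * F y ^+ n.-1 * f y) z.
Proof.
move=> dF; elim: n => [|n IH].
  rewrite (_ : (fun y => _ * f y) = (fun=> 0)); first exact: primitive_at_cst.
  by apply/funext => y; rewrite !mul0r.
rewrite (_ : (fun y => _ * f y) =
    (fun y => F y * (n%:R * F y ^+ n.-1 * f y) + F y ^+ n * f y)).
  rewrite (_ : (fun y => F y ^+ _) = (fun y => F y * F y ^+ n)).
    exact: primitive_atM.
  by apply/funext => y; rewrite exprS.
apply/funext => y /=; case: n {IH} => [|n] /=; first by rewrite !mul0r mulr0 add0r mul1r.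
by rewrite exprS -[in LHS]natr1; ring.
Qed.

End ComplexCalculus.

(** * Moduli and the geometric expansion *)

Section Modulus.
Variable R : realType.
Implicit Types (x y z : R[i]) (rs : seq R[i]).
Local Notation normc := ComplexField.Normc.normc.

Lemma normc_ge_Re z : `|complex.Re z| <= normc z.
Proof.
case: z => x y /=; rewrite -sqrtr_sqr ler_wsqrtr // lerDl; exact: sqr_ge0.
Qed.

Lemma normc_ge_Im z : `|complex.Im z| <= normc z.
Proof.
case: z => x y /=; rewrite -sqrtr_sqr ler_wsqrtr // lerDr; exact: sqr_ge0.
Qed.

Lemma normc_le_ReIm z : normc z <= `|complex.Re z| + `|complex.Im z|.
Proof.
case: z => x y /=; rewrite -[leRHS]ger0_norm ?addr_ge0 // -sqrtr_sqr ler_wsqrtr //.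
rewrite sqrrD !real_normK ?num_real // lerD2r lerDl.
by rewrite mulrn_wge0 // mulr_ge0.
Qed.

Lemma normc_ge0 z : 0 <= normc z.
Proof. by case: z => x y; exact: sqrtr_ge0. Qed.

Lemma normcX z k : normc (z ^+ k) = normc z ^+ k.
Proof.
elim: k => [|k IH]; first by rewrite !expr0 ComplexField.Normc.normc1.
by rewrite !exprS ComplexField.Normc.normcM IH.
Qed.

(** The finite geometric series for 1 / (y - x), with exact remainder. It serves
    both near a point off the contour and near infinity. *)
Lemma geometric_expansion x y N : y != 0 -> y - x != 0 ->
  (y - x)^-1 - \sum_(k < N) x ^+ k * y^-1 ^+ k.+1 = (x / y) ^+ N * (y - x)^-1.
Proof.
move=> y0 yx0; elim: N => [|N IH].
  by rewrite big_ord0 subr0 expr0 mul1r.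
rewrite big_ord_recr /= opprD addrA IH [y^-1 ^+ _]exprSr mulrA -exprMn exprSr.
by move: ((x / y) ^+ N) => q; field; rewrite yx0.
Qed.

Lemma eq0_geometric (x K : R) : 0 <= x -> (forall N, x <= K * 2^-1 ^+ N) -> x = 0.
Proof.
move=> x0 H; apply/eqP; rewrite eq_le x0 andbT.
have : (fun N => K * 2^-1 ^+ N) @ \oo --> (K * 0 : R).
  apply: cvgM; first exact: cvg_cst.
  by apply: cvg_expr; rewrite ger0_norm ?invr_ge0 // invf_lt1 // ltr1n.
rewrite mulr0 => cv.
rewrite -(cvg_lim _ cv) //; apply: limr_ge; first exact: cvgP cv.
by near=> N; exact: H.
Unshelve. all: by end_near.
Qed.

Lemma prod_subr_neq0 rs z : (forall c, c \in rs -> z != c) ->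
  \prod_(c <- rs) (z - c) != 0.
Proof. by move=> H; rewrite prodf_seq_neq0; apply/allP => c /H; rewrite subr_eq0. Qed.

End Modulus.

(** * Simple roots and partial fractions *)

Section SimpleRoots.
Variable F : fieldType.
Implicit Types (d p q : {poly F}) (z : F).

Lemma mup0 z : mup z 0 = 0%N.
Proof.
rewrite /mup; set e := [arg max_(_ > _ | _) _].
by apply/eqP; rewrite -leqn0 -ltnS (leq_trans (ltn_ord e)) // ltnS (size_poly0 F).
Qed.

(** If d and its derivative both vanished at z, then ('X - z) ^+ 2 would divide
    d. *)
Lemma mup1_simple d z : mup z d = 1%N -> root d z /\ d^`().[z] != 0.
Proof.
move=> m1; have d0 : d != 0 by apply: contra_eq_neq m1 => ->; rewrite mup0.
have /factor_theorem[q Eq] : root d z.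
  by rewrite root_factor_theorem XsubC_dvd // m1.
have : ~~ (('X - z%:P) ^+ 2 %| d) by rewrite -mup_ltn // m1.
rewrite Eq => Hd; split; first by rewrite rootM root_XsubC eqxx orbT.
rewrite derivM derivXsubC hornerD !hornerM hornerXsubC subrr mulr0 add0r.
rewrite hornerC mulr1; apply: contra Hd => /eqP q0.
have /factor_theorem[r ->] : root q z by apply/rootP.
by rewrite -mulrA -expr2 dvdp_mull.
Qed.

Lemma dvdp_roots m (lam : 'I_m -> F) p : injective lam ->
  (forall i, root p (lam i)) -> \prod_(i < m) ('X - (lam i)%:P) %| p.
Proof.
move=> il rp; rewrite -(big_map lam predT (fun z => 'X - z%:P)).
apply: uniq_roots_dvdp.
  by apply/allP => z /mapP[i _ ->].
by rewrite uniq_rootsE map_inj_uniq // index_enum_uniq.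
Qed.

(** The classical partial fraction coefficients p(lam i) / d'(lam i): once the
    corresponding simple fractions are removed, the numerator vanishes at every
    lam i, so these roots cancel from the denominator. *)
Lemma partial_fractions m (lam : 'I_m -> F) d p : injective lam ->
  (forall i, root d (lam i)) -> (forall i, d^`().[lam i] != 0) ->
  exists q r, [/\ d = \prod_(i < m) ('X - (lam i)%:P) * q,
    forall i, ~~ root q (lam i) &
    forall z, d.[z] != 0 -> p.[z] / d.[z] = r.[z] / q.[z] +
      \sum_(i < m) p.[lam i] / d^`().[lam i] * (z - lam i)^-1].
Proof.
move=> il rd sd; set P := \prod_(i < m) _.
have [q Eq] := dvdpP _ _ (dvdp_roots il rd); rewrite -/P in Eq.
have rP i : root P (lam i).
  by rewrite /P (bigD1 i) //= rootM root_XsubC eqxx.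
have dE i : d = (d %/ ('X - (lam i)%:P)) * ('X - (lam i)%:P).
  by rewrite divpK // -root_factor_theorem.
have di i : (d %/ ('X - (lam i)%:P)).[lam i] = d^`().[lam i].
  rewrite {2}(dE i) derivM derivXsubC hornerD !hornerM hornerXsubC subrr mulr0.
  by rewrite add0r hornerC mulr1.
have dj i j : j != i -> (d %/ ('X - (lam i)%:P)).[lam j] = 0.
  move=> ji; have /rootP := rd j; rewrite {1}(dE i) hornerM hornerXsubC => /eqP.
  by rewrite mulf_eq0 subr_eq0 (inj_eq il) (negbTE ji) orbF => /eqP.
pose N := p - \sum_(i < m) (p.[lam i] / d^`().[lam i]) *: (d %/ ('X - (lam i)%:P)).
have [j|r Er] := dvdpP _ _ (@dvdp_roots _ lam N il _).
  apply/rootP; rewrite hornerD hornerN horner_sum (bigD1 j) //= hornerZ di.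
  rewrite mulfVK // big1 ?addr0 ?subrr // => i ij.
  by rewrite hornerZ dj ?mulr0 // eq_sym.
exists q, r; split; first by rewrite mulrC.
  move=> i; apply: contra (sd i) => /rootP q0; have /rootP P0 := rP i.
  by rewrite Eq derivM hornerD !hornerM q0 P0 mulr0 mul0r addr0.
move=> z dz; have /norP[qz Pz] : ~~ ((q.[z] == 0) || (P.[z] == 0)).
  by rewrite -mulf_eq0 -hornerM -Eq.
have pE : p = N + \sum_(i < m) (p.[lam i] / d^`().[lam i]) *: (d %/ ('X - (lam i)%:P)).
  by rewrite subrK.
rewrite {1}pE hornerD mulrDl; congr (_ + _).
  by rewrite Er Eq !hornerM -/P; field; rewrite qz Pz.
rewrite horner_sum mulr_suml; apply: eq_bigr => i _; rewrite hornerZ -mulrA.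
congr (_ * _); have := dz; move: (d %/ _) (dE i) => e ->.
by rewrite hornerM hornerXsubC mulf_eq0 => /norP[n1 n2]; field; rewrite n1 n2.
Qed.

End SimpleRoots.

(** * Matrix polynomials and their resolvents *)

Section PolynomialMatrix.
Variables (F : fieldType) (n l : nat) (A : 'I_l.+1 -> 'M[F]_n).

Definition mppoly : 'M[{poly F}]_n := \sum_(j < l.+1) 'X^j *: map_mx polyC (A j).

Lemma map_horner_mppoly z : map_mx (horner_eval z) mppoly = mpeval A z.
Proof.
rewrite /mppoly /mpeval raddf_sum; apply: eq_bigr => j _.
by apply/matrixP => i k; rewrite !mxE /= /horner_eval hornerM hornerXn hornerC.
Qed.

Lemma horner_mpdet z : (mpdet A).[z] = \det (mpeval A z).
Proof. by rewrite -map_horner_mppoly det_map_mx. Qed.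

Lemma mpeigenvalue_root z : mpeigenvalue A z <-> root (mpdet A) z.
Proof.
rewrite rootE horner_mpdet; split.
  move=> [x [x0 Px]]; apply: contraNT x0 => d0.
  have U : mpeval A z \in unitmx by rewrite unitmxE unitfE.
  by rewrite -[x](mulKmx U) Px mulmx0.
rewrite -det_tr => /det0P[w w0 wP]; exists w^T; split.
  by apply: contraNneq w0 => w0; rewrite -[w]trmxK w0 trmx0.
by rewrite -[mpeval A z]trmxK -trmx_mul wP trmx0.
Qed.

(** Every term of the determinant is a product of n entries of degree at most
    l. *)
Lemma size_mpdet : (size (mpdet A) <= (l * n).+1)%N.
Proof.
apply: leq_trans (size_sum _ _ _) _; apply/bigmax_leqP => s _.
rewrite mulr_sign (fun_if (fun p : {poly F} => size p)) size_polyN if_same.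
apply: leq_trans (size_prod_leq _ _) _.
rewrite card_ord leq_subLR addnS ltnS; apply: leq_trans (_ : \sum_(i < n) l.+1 <= _)%N.
  apply: leq_sum => i _; rewrite summxE; apply: leq_trans (size_sum _ _ _) _.
  apply/bigmax_leqP => j _; rewrite !mxE mulrC mul_polyC.
  by apply: leq_trans (size_scale_leq _ _) _; rewrite size_polyXn.
by rewrite sum_nat_const card_ord mulnS mulnC.
Qed.

(** By Cramer's rule, the numerator of P(z)^-1 v over the common denominator
    det P(z). *)
Definition resolvent_num (v : 'cV[F]_n) : 'cV[{poly F}]_n :=
  \adj mppoly *m map_mx polyC v.

Lemma map_resolvent_num v z :
  map_mx (horner_eval z) (resolvent_num v) = \adj (mpeval A z) *m v.
Proof.
rewrite /resolvent_num map_mxM map_mx_adj map_horner_mppoly; congr (_ *m _).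
by apply/matrixP => i j; rewrite !mxE /= /horner_eval hornerC.
Qed.

Lemma resolvent_numE v z i : (mpdet A).[z] != 0 ->
  (invmx (mpeval A z) *m v) i ord0 = (resolvent_num v i ord0).[z] / (mpdet A).[z].
Proof.
rewrite horner_mpdet => d0; have U : mpeval A z \in unitmx by rewrite unitmxE unitfE.
rewrite /invmx U -scalemxAl -map_resolvent_num mxE [in RHS]mulrC; congr (_ * _).
by rewrite mxE.
Qed.

(** P times its adjugate is det P, which vanishes at an eigenvalue; this is why
    residues are null vectors. *)
Lemma mpeval_resolvent_num v z : root (mpdet A) z ->
  mpeval A z *m map_mx (horner_eval z) (resolvent_num v) = 0.
Proof.
rewrite rootE horner_mpdet map_resolvent_num mulmxA mul_mx_adj => /eqP->.
by rewrite mul_scalar_mx scale0r.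
Qed.

End PolynomialMatrix.

(** * Pairs with a diagonalized second component *)

Section DiagonalizedPair.
Variables (F : fieldType) (n l m : nat).
Implicit Types (A : 'I_l.+1 -> 'M[F]_n) (lam : 'I_m -> F).
Implicit Types (X : 'M[F]_(n, m)) (U : 'M[F]_m).

Definition diag lam : 'M[F]_m := diag_mx (\row_i lam i).

Lemma diagX lam j : diag lam ^+ j = diag (fun i => lam i ^+ j).
Proof.
elim: j => [|j IH].
  by apply/matrixP => i k; rewrite !mxE expr0.
rewrite exprS IH -mulmxE; apply/matrixP => i k.
rewrite mul_diag_mx !mxE; case: eqP => [->|_]; last by rewrite !mulr0n mulr0.
by rewrite !mulr1n exprS.
Qed.

Lemma conj_diagX lam U j : U \in unitmx ->
  (invmx U *m diag lam *m U) ^+ j = invmx U *m diag (fun i => lam i ^+ j) *m U.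
Proof.
move=> Uu; rewrite -diagX; elim: j => [|j IH].
  by rewrite !expr0 mulmx1 mulVmx.
by rewrite exprS IH [diag lam ^+ j.+1]exprS -!mulmxE !mulmxA mulmxK.
Qed.

(** After the base change U, column i of the pair is P(lam i) applied to column
    i of X. *)
Lemma mppair_diag A lam X U : U \in unitmx ->
  (forall i, mpeval A (lam i) *m col i X = 0) ->
  mppair A (X *m U) (invmx U *m diag lam *m U) = 0.
Proof.
move=> Uu PX.
suff E : \sum_(j < l.+1) A j *m X *m diag (fun i => lam i ^+ j) = 0.
  rewrite -[RHS](mul0mx _ U) -E mulmx_suml; apply: eq_bigr => j _.
  by rewrite conj_diagX // !mulmxA mulmxK.
apply/matrixP => r i; rewrite [RHS]mxE.
have <- : (mpeval A (lam i) *m col i X) r ord0 = 0 by rewrite PX mxE.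
rewrite /mpeval mulmx_suml !summxE; apply: eq_bigr => j _.
rewrite /diag mul_mx_diag -scalemxAl !mxE mulrC; congr (_ * _).
by apply: eq_bigr => k _; rewrite !mxE.
Qed.

Lemma char_poly_diag lam U : U \in unitmx ->
  char_poly (invmx U *m diag lam *m U) = \prod_(i < m) ('X - (lam i)%:P).
Proof.
move=> Uu; have -> : \prod_(i < m) ('X - (lam i)%:P) = char_poly (diag lam).
  rewrite char_poly_trig ?diag_mx_is_trig //; apply: eq_bigr => i _.
  by rewrite !mxE eqxx mulr1n.
rewrite /char_poly.
have -> : char_poly_mx (invmx U *m diag lam *m U) =
    map_mx polyC (invmx U) *m char_poly_mx (diag lam) *m map_mx polyC U.
  rewrite /char_poly_mx mulmxBr mulmxBl !map_mxM; congr (_ - _).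
  by rewrite mul_mx_scalar -scalemxAl -map_mxM mulVmx // map_mx1 scalemx1.
rewrite !det_mulmx mulrC mulrA -det_mulmx -map_mxM mulmxV // map_mx1 det1 mul1r.
by [].
Qed.

Lemma mup_prod_XsubC lam i : injective lam ->
  mup (lam i) (\prod_(j < m) ('X - (lam j)%:P)) = 1%N.
Proof.
move=> il; rewrite (bigD1 i) //= mupMl.
  by have := mup_XsubCX 1 (lam i) (lam i); rewrite expr1 eqxx.
rewrite rootE horner_prod prodf_seq_neq0; apply/allP => j _; apply/implyP => ji.
by rewrite hornerXsubC subr_eq0 (inj_eq il) eq_sym.
Qed.

Lemma Vandermonde_unit lam : injective lam ->
  Vandermonde m (\row_i lam i) \in unitmx.
Proof.
move=> il; rewrite unitmxE det_Vandermonde unitfE prodf_seq_neq0.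
apply/allP => i _ /=; rewrite prodf_seq_neq0; apply/allP => j _; apply/implyP => ij.
by rewrite !mxE subr_eq0 (inj_eq il) eq_sym neq_ltn ij.
Qed.

(** A vector killed by X L^j for all j < m, read on one row of X, is a solution
    of a Vandermonde system with distinct nodes, hence is 0 wherever that row of
    X is nonzero; and each column of X has a nonzero entry. *)
Lemma minimal_pair_diag lam X U : U \in unitmx -> injective lam ->
  (forall i, col i X != 0) -> minimal_pair (X *m U) (invmx U *m diag lam *m U).
Proof.
move=> Uu il X0; exists m; rewrite -mxrank_tr; apply/eqP.
apply: inj_row_free => v vM.
pose y := U *m v^T.
have My j : (j < m)%N -> X *m diag (fun i => lam i ^+ j) *m y = 0.
  move=> jm; have m0 : (0 < m)%N by apply: leq_ltn_trans jm.
  have jm' : (m.-1 - j < m)%N.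
    by rewrite (leq_ltn_trans (leq_subr _ _)) // prednK.
  have : (\mxcol_(i < m) (X *m U *m (invmx U *m diag lam *m U) ^+ (m.-1 - i))) *m v^T = 0.
    by rewrite -[_ *m v^T]trmxK trmx_mul trmxK vM trmx0.
  move/(congr1 (fun B => submxcol B (Ordinal jm'))).
  rewrite -submxcol_mul mxcolK submxcol0 /= subKn; last first.
    by rewrite -ltnS prednK.
  by rewrite conj_diagX // /y !mulmxA mulmxK.
suff y0 : y = 0 by rewrite -[v]trmxK -[v^T](mulKmx Uu) -/y y0 mulmx0 trmx0.
clearbody y; apply/colP => i; rewrite [RHS]mxE; apply/eqP; apply: contraNT (X0 i) => yi.
apply/eqP/colP => r; rewrite !mxE.
pose c := \col_k (X r k * y k ord0).
have Vc : Vandermonde m (\row_i lam i) *m c = 0.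
  apply/colP => j; have /matrixP/(_ r ord0) := My j (ltn_ord j).
  rewrite !mxE => E; rewrite -[RHS]E; apply: eq_bigr => k _.
  by rewrite /diag mul_mx_diag !mxE mulrCA mulrA.
have /colP/(_ i) : c = 0 by rewrite -[c](mulKmx (Vandermonde_unit il)) Vc mulmx0.
by rewrite !mxE => /eqP; rewrite mulf_eq0 (negbTE yi) orbF => /eqP.
Qed.

(** V D is a left factor of the whole pencil, so det D divides its
    determinant. *)
Lemma pencil_diag_neq0 (V W : 'M[F]_m) (delta : 'I_m -> F) (lam : 'I_m -> F) :
  mpregular (pencil (V *m diag delta *m diag lam *m W) (V *m diag delta *m W)) ->
  forall i, delta i != 0.
Proof.
rewrite /mpregular /mpdet -(mulmxA _ (diag lam)) => H i.
have : \det (map_mx polyC (V *m diag delta)) != 0.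
  apply: contraNneq H; move: (V *m _) => B d0.
  rewrite !big_ord_recl big_ord0 addr0 /pencil /= expr0 scale1r.
  by rewrite map_mxN scalerN !(map_mxM _ B) scalemxAr -mulmxBr det_mulmx d0 mul0r.
rewrite det_map_mx polyC_eq0 det_mulmx mulf_eq0 det_diag => /norP[_].
by rewrite prodf_seq_neq0 => /allP/(_ i (mem_index_enum _)); rewrite mxE.
Qed.

End DiagonalizedPair.

(** * Contour integrals *)

Section ContourIntegral.
Variables (R : realType) (a : R) (s : seq R) (g : R -> R[i]).
Local Notation b := (last a s).
Local Notation mu := (@lebesgue_measure R).
Local Notation normc := ComplexField.Normc.normc.
Hypotheses (ps : path <%R a s) (cg : ccont `[a, b] g) (gab : g a = g b).
Hypothesis C1g : on_pieces (fun x y => C1_on x y (re g) /\ C1_on x y (im g)) a s.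
Implicit Types (f F : R[i] -> R[i]) (z w c : R[i]) (t : R).
Implicit Types (p : {poly R[i]}) (rs : seq R[i]).

Local Notation CI := (contour_integral a b g).

Lemma trace_g t : `[a, b]%classic t -> trace a b g (g t).
Proof. by move=> tab; exists t. Qed.

Lemma path_derive_g :
  on_pieces (fun x y => forall t, x < t < y -> path_derive g t (cderive g t)) a s.
Proof.
apply: on_pieces_imp C1g => // x y ax xy yb [[dr _ hr] [di _ hi]] t txy.
have r := hr _ txy; have i := hi _ txy.
by split; rewrite /= derive1E; apply: derivableP; [case: r|case: i].
Qed.

Lemma pw_cderive :
  pw_continuous (re (cderive g)) a s /\ pw_continuous (im (cderive g)) a s.
Proof.
split; apply: on_pieces_imp C1g => // x y ax xy yb [[dr cr hr] [di ci hi]].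
- exists dr => // t /hr r; rewrite /re /= derive1E; exact: derive_val.
- exists di => // t /hi r; rewrite /im /= derive1E; exact: derive_val.
Qed.

(** Continuity on the trace, in the only form that a contour integral sees. *)
Definition path_continuous f := ccont `[a, b] (fun t => f (g t)).

Lemma pw_integrand f : path_continuous f ->
  pw_continuous (re (fun t => f (g t) * cderive g t)) a s /\
  pw_continuous (im (fun t => f (g t) * cderive g t)) a s.
Proof.
move=> [cr ci]; have [pr pi] := pw_cderive; split.
- rewrite (_ : re _ = re (fun t => f (g t)) * re (cderive g)
      + - (im (fun t => f (g t)) * im (cderive g))); last first.
    by apply/funext => t; rewrite /re complex_ReM.
  by apply: pw_continuousD; [|apply: pw_continuousN]; exact: pw_continuousM.
- rewrite (_ : im _ = re (fun t => f (g t)) * im (cderive g)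
      + im (fun t => f (g t)) * re (cderive g)); last first.
    by apply/funext => t; rewrite /im complex_ImM.
  by apply: pw_continuousD; exact: pw_continuousM.
Qed.

Lemma integrand_integrable f : path_continuous f ->
  mu.-integrable `[a, b] (EFin \o re (fun t => f (g t) * cderive g t)) /\
  mu.-integrable `[a, b] (EFin \o im (fun t => f (g t) * cderive g t)).
Proof.
by move=> /pw_integrand[pr pi]; split; exact: pw_continuous_integrable.
Qed.

Lemma eq_contour_integral f1 f2 : (forall z, trace a b g z -> f1 z = f2 z) ->
  CI f1 = CI f2.
Proof.
move=> e; rewrite /contour_integral /cintegral.
by congr (_ +i* _); apply: eq_Rintegral => t /set_mem tab;
  rewrite e //; exact: trace_g.
Qed.

Lemma contour_integralD f1 f2 : path_continuous f1 -> path_continuous f2 ->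
  CI (fun z => f1 z + f2 z) = CI f1 + CI f2.
Proof.
move=> /integrand_integrable[r1 i1] /integrand_integrable[r2 i2].
rewrite /contour_integral /cintegral; apply/eqP; rewrite eq_complex /=; apply/andP.
by split; apply/eqP; rewrite -RintegralD //; apply: eq_Rintegral => t _;
  rewrite mulrDl ?complex_ReD ?complex_ImD.
Qed.

Lemma contour_integralZ c f : path_continuous f ->
  CI (fun z => c * f z) = c * CI f.
Proof.
move=> /integrand_integrable[r i].
rewrite /contour_integral /cintegral; apply/eqP; rewrite eq_complex; apply/andP.
set hr := re _ in r; set hi := im _ in i.
have zr (k : R) : k * \int[mu]_(t in `[a, b]) hr t = \int[mu]_(t in `[a, b]) (k * hr t).
  by rewrite RintegralZl.
have zi (k : R) : k * \int[mu]_(t in `[a, b]) hi t = \int[mu]_(t in `[a, b]) (k * hi t).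
  by rewrite RintegralZl.
have ir (k : R) : mu.-integrable `[a, b] (EFin \o (fun t => k * hr t)).
  have := @integrableZl _ _ R mu `[a, b] (measurable_itv _) k _ r; apply.
have ii (k : R) : mu.-integrable `[a, b] (EFin \o (fun t => k * hi t)).
  have := @integrableZl _ _ R mu `[a, b] (measurable_itv _) k _ i; apply.
split; apply/eqP; rewrite ?complex_ReM ?complex_ImM /=.
- rewrite -[X in _ = _ * X - _]/(\int[mu]_(t in `[a, b]) hr t).
  rewrite -[X in _ = _ - _ * X]/(\int[mu]_(t in `[a, b]) hi t).
  rewrite zr zi -RintegralB //.
  by apply: eq_Rintegral => t _; rewrite -mulrA complex_ReM.
- rewrite -[X in _ = _ * X + _]/(\int[mu]_(t in `[a, b]) hi t).
  rewrite -[X in _ = _ + _ * X]/(\int[mu]_(t in `[a, b]) hr t).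
  rewrite zr zi -RintegralD //.
  by apply: eq_Rintegral => t _; rewrite -mulrA complex_ImM.
Qed.

(** The real and imaginary parts of F along the path are primitives of those of
    the integrand, and the path is closed. *)
Lemma contour_integral_primitive F f : path_continuous F ->
  path_continuous f -> (forall z, trace a b g z -> primitive_at F f z) ->
  CI f = 0.
Proof.
move=> [cr ci] /pw_integrand[pr pi] dF.
have D : on_pieces (fun x y => forall t, x < t < y ->
    path_derive (fun t => F (g t)) t (f (g t) * cderive g t)) a s.
  apply: on_pieces_imp path_derive_g => // x y ax xy yb H t txy.
  apply: dF (H _ txy) => //; apply: trace_g => /=.
  move: txy => /andP[xt ty]; rewrite in_itv /= (le_trans ax (ltW xt)).
  exact: le_trans (ltW ty) yb.
rewrite /contour_integral /cintegral.
rewrite (@pw_FTC _ _ (re (fun t => F (g t))) _ _ ps pr cr); last first.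
  by apply: on_pieces_imp D => // x y _ _ _ H t /H[].
rewrite (@pw_FTC _ _ (im (fun t => F (g t))) _ _ ps pi ci); last first.
  by apply: on_pieces_imp D => // x y _ _ _ H t /H[].
by rewrite /re /im gab !subrr.
Qed.

(** L is twice the integral of |Re g'| + |Im g'|, which bounds the length of the
    path; the real and imaginary parts are estimated separately. *)
Lemma contour_integral_bound : exists2 L : R, 0 <= L &
  forall f M, path_continuous f ->
    (forall z, trace a b g z -> normc (f z) <= M) -> normc (CI f) <= M * L.
Proof.
have [pr pi] := pw_cderive.
have ir := integrable_norm (pw_continuous_integrable ps pr).
have ii := integrable_norm (pw_continuous_integrable ps pi).
set len := fun t => `|re (cderive g) t| + `|im (cderive g) t|.
have iri : mu.-integrable `[a, b] (EFin \o len).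
  have := @integrableD _ _ R mu `[a, b] (measurable_itv _) _ _ ir ii; apply.
pose L := \int[mu]_(t in `[a, b]) len t.
have L0 : 0 <= L by apply: Rintegral_ge0 => t _; rewrite addr_ge0.
exists (L + L) => [|f M af fM]; first by rewrite addr_ge0.
have [jr ji] := integrand_integrable af.
have ML : M * L = \int[mu]_(t in `[a, b]) (M * len t).
  by rewrite -RintegralZl.
have iM : mu.-integrable `[a, b] (EFin \o (fun t => M * len t)).
  have := @integrableZl _ _ R mu `[a, b] (measurable_itv _) M _ iri; apply.
have key t : `[a, b]%classic t -> normc (f (g t) * cderive g t) <= M * len t.
  move=> /trace_g/fM fM'; rewrite ComplexField.Normc.normcM.
  by apply: ler_pM => //; [exact: normc_ge0|exact: normc_ge0|exact: normc_le_ReIm].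
rewrite mulrDr; apply: le_trans (normc_le_ReIm _) _; rewrite /contour_integral /=.
apply: lerD; apply: le_trans (le_normr_Rintegral _ _) _ => //; rewrite ML;
  apply: le_Rintegral => //; try exact: (integrable_norm jr); try exact: (integrable_norm ji).
- by move=> t /key; apply: le_trans; exact: normc_ge_Re.
- by move=> t /key; apply: le_trans; exact: normc_ge_Im.
Qed.

Lemma path_continuous_cst c : path_continuous (fun=> c).
Proof. exact: ccont_cst. Qed.

Lemma path_continuous_id : path_continuous id. Proof. exact: cg. Qed.

Lemma path_continuous_horner p : path_continuous (horner p).
Proof. exact: ccont_horner. Qed.

Lemma path_continuousM f1 f2 : path_continuous f1 -> path_continuous f2 ->
  path_continuous (fun z => f1 z * f2 z).
Proof. exact: ccontM. Qed.

Lemma path_continuousD f1 f2 : path_continuous f1 -> path_continuous f2 ->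
  path_continuous (fun z => f1 z + f2 z).
Proof. exact: ccontD. Qed.

Lemma path_continuousX f n : path_continuous f -> path_continuous (fun z => f z ^+ n).
Proof. exact: ccontX. Qed.

Lemma path_continuousV f : (forall z, trace a b g z -> f z != 0) -> path_continuous f ->
  path_continuous (fun z => (f z)^-1).
Proof. by move=> f0; apply: ccontV => t tab; apply: f0; exact: trace_g. Qed.

Lemma path_continuous_sum (I : Type) (r : seq I) (F : I -> R[i] -> R[i]) :
  (forall i, path_continuous (F i)) -> path_continuous (fun z => \sum_(i <- r) F i z).
Proof.
move=> iF; elim: r => [|i r IH].
  by under eq_fun do rewrite big_nil; exact: path_continuous_cst.
by under eq_fun do rewrite big_cons; exact: path_continuousD.
Qed.

Lemma path_continuous_off z : ~ trace a b g z -> path_continuous (fun y => (y - z)^-1).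
Proof.
move=> ntz; apply: (@path_continuousV (fun y => y - z)).
  by move=> y ty; apply/negP; rewrite subr_eq0 => /eqP yz; apply: ntz; rewrite -yz.
by apply: (@path_continuousD id (fun=> - z)); [exact: path_continuous_id|
  exact: path_continuous_cst].
Qed.

Lemma contour_integral0 : CI (fun=> 0) = 0.
Proof.
rewrite -[RHS](mul0r (CI (fun=> 0))).
rewrite -(contour_integralZ 0 (path_continuous_cst 0)).
by apply: eq_contour_integral => z _; rewrite mul0r.
Qed.

Lemma contour_integral_sum (I : Type) (r : seq I) (F : I -> R[i] -> R[i]) :
  (forall i, path_continuous (F i)) ->
  CI (fun z => \sum_(i <- r) F i z) = \sum_(i <- r) CI (F i).
Proof.
move=> iF; elim: r => [|i r IH].
  rewrite big_nil -[RHS]contour_integral0.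
  by apply: eq_contour_integral => z _; rewrite big_nil.
rewrite big_cons -IH -contour_integralD //; last exact: path_continuous_sum.
by apply: eq_contour_integral => z _; rewrite big_cons.
Qed.

Lemma contour_integral_exp k : CI (fun z => z ^+ k) = 0.
Proof.
apply: (@contour_integral_primitive
  (fun z => k.+1%:R^-1 * z ^+ k.+1)).
- by apply: path_continuousM; [exact: path_continuous_cst|
    exact/path_continuousX/path_continuous_id].
- exact/path_continuousX/path_continuous_id.
- move=> z _.
  have := primitive_atM (@primitive_at_cst R k.+1%:R^-1 z)
    (primitive_atX k.+1 (@primitive_at_id R z)).
  rewrite (_ : (fun y => _ + _) = fun z => z ^+ k) //; apply/funext => y.
  by rewrite mulr0 addr0 mulr1 mulKf ?pnatr_eq0.
Qed.

Lemma contour_integral_horner p : CI (horner p) = 0.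
Proof.
have -> : horner p = (fun z => \sum_(i < size p) p`_i * z ^+ i).
  by apply/funext => z; rewrite horner_coef.
rewrite contour_integral_sum => [|i].
  rewrite big1 // => i _.
  rewrite contour_integralZ ?contour_integral_exp ?mulr0 //.
  exact/path_continuousX/path_continuous_id.
by apply: path_continuousM; [exact: path_continuous_cst|
    exact/path_continuousX/path_continuous_id].
Qed.

Lemma contour_integral_pole z k : ~ trace a b g z ->
  CI (fun y => (y - z)^-1 ^+ k.+2) = 0.
Proof.
move=> ntz; have i1 := path_continuous_off ntz.
apply: (@contour_integral_primitive
  (fun y => - k.+1%:R^-1 * (y - z)^-1 ^+ k.+1)).
- by apply: path_continuousM; [exact: path_continuous_cst|exact: path_continuousX].
- exact: path_continuousX.
- move=> y ty.
  have yz : y - z != 0.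
    by apply/negP; rewrite subr_eq0 => /eqP yz; apply: ntz; rewrite -yz.
  have d0 : primitive_at (fun y => y - z) (fun=> 1 + 0) y.
    by apply: primitive_atD; [exact: primitive_at_id|exact: primitive_at_cst].
  have := primitive_atM (@primitive_at_cst R (- k.+1%:R^-1) y)
    (primitive_atX k.+1 (@primitive_atV R (fun y => y - z) _ y yz d0)).
  rewrite (_ : (fun y => _ + _) = fun y => (y - z)^-1 ^+ k.+2) //.
  apply/funext => x; rewrite mulr0 !addr0 mulr1 !mulNr !mulrN opprK mulrA.
  by rewrite mulKf ?pnatr_eq0 //= -exprVn -exprD addn2.
Qed.

(** * The integral of a simple pole *)

(** 2 i pi times the winding number of the path about z. *)
Definition pole_integral z := CI (fun y => (y - z)^-1).

(** A substitute for passing to the limit under the integral sign: the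
    approximants all have the same integral. *)
Lemma contour_integral_approx f c (K : R) : path_continuous f ->
  (forall N, exists fN, [/\ path_continuous fN, CI fN = c &
     forall z, trace a b g z -> normc (f z - fN z) <= K * 2^-1 ^+ N]) ->
  CI f = c.
Proof.
move=> fi H; have [L L0 HL] := contour_integral_bound.
apply/eqP; rewrite -subr_eq0; apply/eqP/ComplexField.Normc.eq0_normc.
apply: (@eq0_geometric _ _ (K * L)) => [|N]; first exact: normc_ge0.
have [fN [iN <- HN]] := H N.
have im : path_continuous (fun z => -1 * fN z).
  by apply: path_continuousM => //; exact: path_continuous_cst.
rewrite -mulN1r -contour_integralZ // -contour_integralD //.
rewrite mulrAC; apply: HL; first exact: path_continuousD.
by move=> z /HN; rewrite mulN1r.
Qed.

(** Expanding 1 / (y - w) in powers of (w - z) / (y - z), the constant term gives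
    the integral at z, and the later terms are poles of order at least two. *)
Lemma pole_integral_near z w (delta : R) : 0 < delta ->
  (forall y, trace a b g y -> delta <= normc (y - z)) ->
  normc (w - z) <= delta / 2 -> pole_integral w = pole_integral z.
Proof.
move=> d0 Hd wz.
have n0 y : trace a b g y -> 0 < normc (y - z).
  by move=> /Hd; exact: lt_le_trans.
have ny y : trace a b g y -> delta / 2 <= normc (y - w).
  move=> /Hd ty.
  have := le_normcD (y - w) (w - z); rewrite addrA subrK.
  move: wz ty; lra.
have nz : ~ trace a b g z.
  by move=> /n0; rewrite subrr ComplexField.Normc.normc0 ltxx.
have nw : ~ trace a b g w.
  by move=> /ny; rewrite subrr ComplexField.Normc.normc0; lra.
apply: (@contour_integral_approx _ _ (2 / delta)); first exact: path_continuous_off.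
move=> N; exists (fun y => \sum_(k < N.+1) (w - z) ^+ k * (y - z)^-1 ^+ k.+1).
have it k : path_continuous (fun y => (w - z) ^+ k * (y - z)^-1 ^+ k.+1).
  by apply: path_continuousM; [exact: path_continuous_cst|
    exact/path_continuousX/path_continuous_off].
split.
- by apply: path_continuous_sum => k; exact: it.
- rewrite contour_integral_sum => [|k]; last exact: it.
  rewrite big_ord_recl big1 ?addr0 => [|k _].
    by apply: eq_contour_integral => y _; rewrite expr0 mul1r expr1.
  rewrite contour_integralZ; last exact/path_continuousX/path_continuous_off.
  by rewrite contour_integral_pole ?mulr0.
- move=> y ty.
  have -> : y - w = (y - z) - (w - z) by ring.
  rewrite geometric_expansion; first last.
  + by rewrite opprB addrA subrK; apply/eqP => E; move: (ny _ ty);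
      rewrite E ComplexField.Normc.normc0; lra.
  + by apply/eqP => E; move: (n0 _ ty); rewrite E ComplexField.Normc.normc0 ltxx.
  have -> : y - z - (w - z) = y - w by ring.
  rewrite ComplexField.Normc.normcM ComplexField.Normc.normcV mulrC.
  apply: ler_pM; rewrite ?invr_ge0 ?normc_ge0 //.
    by rewrite -[2 / delta]invrK invf_div lef_pV2 ?posrE ?divr_gt0 ?ny //;
      apply: lt_le_trans (ny _ ty); rewrite divr_gt0.
  have q2 : normc ((w - z) / (y - z)) <= 2^-1.
    rewrite ComplexField.Normc.normcM ComplexField.Normc.normcV.
    rewrite ler_pdivrMr ?n0 //; move: (Hd _ ty) wz; lra.
  rewrite normcX; apply: le_trans (_ : _ <= 2^-1 ^+ N.+1) _.
    by rewrite ler_pXn2r ?nnegrE ?normc_ge0.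
  by rewrite exprS ler_piMl ?exprn_ge0 // invf_le1 // ler1n.
Qed.

(** Expanding 1 / (y - w) in powers of y / w, all terms are polynomials in y. *)
Lemma pole_integral_far : exists M : R, forall w, M <= normc w ->
  pole_integral w = 0.
Proof.
have ab : a <= b by exact: path_le_last.
have [t0 _ Ht0] := EVT_max ab (ccont_sqnorm cg).
pose M := Num.sqrt (re g t0 ^+ 2 + im g t0 ^+ 2) + 1.
have M0 : 0 < M by rewrite ltr_wpDl ?sqrtr_ge0.
have HM y : trace a b g y -> normc y <= M.
  move=> [t tab <-]; apply: le_trans (_ : _ <= Num.sqrt (re g t ^+ 2 + im g t ^+ 2)) _.
    by rewrite /re /im; case: (g t).
  by rewrite ler_wpDr // ler_wsqrtr // Ht0.
exists (2 * M) => w wM.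
have ny y : trace a b g y -> M <= normc (w - y).
  move=> /HM yM; have := le_normcD (w - y) y; rewrite subrK; lra.
have nw0 : w != 0.
  by apply/eqP => E; move: wM; rewrite E ComplexField.Normc.normc0; lra.
have nwy y : trace a b g y -> w - y != 0.
  by move=> /ny; apply: contraTneq => ->; rewrite ComplexField.Normc.normc0 -ltNge.
have nw : ~ trace a b g w by move=> /nwy; rewrite subrr eqxx.
apply: (@contour_integral_approx _ _ M^-1); first exact: path_continuous_off.
move=> N; pose p : {poly R[i]} := - \sum_(k < N) w^-1 ^+ k.+1 *: 'X^k.
exists (horner p); split.
- exact: path_continuous_horner.
- exact: contour_integral_horner.
- move=> y ty.
  have -> : (y - w)^-1 - p.[y] = - ((y / w) ^+ N * (w - y)^-1).
    rewrite -geometric_expansion ?nwy // /p hornerN opprK -opprB invrN opprB addrC.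
    congr (_ - _); rewrite horner_sum; apply: eq_bigr => k _.
    by rewrite hornerZ hornerXn mulrC.
  rewrite normcN ComplexField.Normc.normcM mulrC.
  apply: ler_pM; rewrite ?normc_ge0 //.
    by rewrite ComplexField.Normc.normcV lef_pV2 ?posrE ?ny // (lt_le_trans M0) ?ny.
  rewrite normcX lerXn2r ?nnegrE ?normc_ge0 //.
  rewrite ComplexField.Normc.normcM ComplexField.Normc.normcV ler_pdivrMr.
    by move: (HM _ ty) wM; lra.
  by move: wM; lra.
Qed.

Lemma trace_dist z : ~ trace a b g z ->
  exists2 delta : R, 0 < delta & forall y, trace a b g y -> delta <= normc (y - z).
Proof.
move=> ntz; have ab : a <= b by exact: path_le_last.
have cgz : ccont `[a, b] (fun t => g t - z) by apply: ccontD => //; exact: ccont_cst.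
have [t0 t0ab Ht0] := EVT_min ab (ccont_sqnorm cgz).
exists (Num.sqrt (re (fun t => g t - z) t0 ^+ 2 + im (fun t => g t - z) t0 ^+ 2)).
  rewrite sqrtr_gt0 lt_neqAle addr_ge0 ?sqr_ge0 // andbT eq_sym.
  apply: sqnormc_neq0; apply/negP; rewrite subr_eq0 => /eqP E.
  by apply: ntz; exists t0.
move=> y [t tab <-].
apply: le_trans (_ : Num.sqrt (re (fun t => g t - z) t ^+ 2 +
                               im (fun t => g t - z) t ^+ 2) <= _).
  by rewrite ler_wsqrtr // Ht0.
by rewrite /re /im; case: (g t - z).
Qed.

Lemma pole_integral_locally_cst z : ~ trace a b g z ->
  \forall w \near (z : R[i]^o), ~ trace a b g w /\ pole_integral w = pole_integral z.
Proof.
move=> /trace_dist[delta d0 Hd].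
apply/nbhs_ballP; exists ((delta / 2)%:C) => [|w /=].
  by rewrite /= ltcR divr_gt0.
rewrite /ball /= distrC => wz.
have {}wz : normc (w - z) < delta / 2 by rewrite -ltcR.
split.
  move=> /Hd; have := wz; lra.
by apply: (pole_integral_near d0 Hd); exact: ltW.
Qed.

(** A locally constant function on a connected set: its level set is open, and so
    is the complement of that level set off the trace. *)
Lemma pole_integral_component z w :
  connected_component (~` trace a b g : set R[i]^o) z w ->
  pole_integral w = pole_integral z.
Proof.
move=> Kw; set K := connected_component _ _ in Kw.
have sub : K `<=` ~` trace a b g by exact: connected_component_sub.
have ntz : ~ trace a b g z.
  move=> tz; move: Kw; rewrite /K connected_component_out //; exact.
have open_level (P : set R[i]) :
    @open R[i]^o [set y | ~ trace a b g y /\ P (pole_integral y)].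
  rewrite openE => y [nty Py]; rewrite /interior.
  apply: filterS (pole_integral_locally_cst nty) => x [ntx e].
  by split => //=; rewrite e.
have : K `&` [set y | ~ trace a b g y /\ pole_integral y = pole_integral z] = K.
  apply: component_connected.
  - by exists z; split => //; exact: connected_component_refl.
  - by exists [set y | ~ trace a b g y /\ pole_integral y = pole_integral z] => //;
      exact: (open_level (fun x => x = pole_integral z)).
  - exists (~` [set y | ~ trace a b g y /\ pole_integral y <> pole_integral z]).
      by apply: open_closedC; exact: (open_level (fun x => x <> pole_integral z)).
    apply/seteqP; split=> y /= [Ky].
      by move=> [_ e]; split => // -[].
    move=> H; split => //; split; first exact: sub.
    by apply: contrapT => ne; apply: H; split => //; exact: sub.
by move=> E; move: Kw; rewrite -E => -[_ []].
Qed.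

(** The component of z is unbounded, so it contains points so far away that the
    integral vanishes there. *)
Lemma pole_integral_outside z : ~ trace a b g z -> ~ contour_interior a b g z ->
  pole_integral z = 0.
Proof.
move=> ntz nint; have [M HM] := pole_integral_far.
have [w Kw wM] : exists2 w, connected_component (~` trace a b g : set R[i]^o) z w &
    M <= normc w.
  apply: contrapT => H; apply: nint; split => //.
  exists M%:C; split; first by apply/complex_realP; exists M.
  move=> x Mx y Ky /=; apply: le_trans (ltW Mx).
  rewrite -[`|y|]/((normc y)%:C) lecR leNgt; apply/negP => yM.
  by apply: H; exists y => //; exact: ltW.
by rewrite -(pole_integral_component Kw) HM.
Qed.

(** * Residues *)

Definition off_trace rs := forall c, c \in rs -> ~ trace a b g c.

Lemma path_continuous_frac p rs : off_trace rs ->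
  path_continuous (fun z => p.[z] / \prod_(c <- rs) (z - c)).
Proof.
move=> off; apply: path_continuousM; first exact: path_continuous_horner.
apply: (@path_continuousV (fun z => \prod_(c <- rs) (z - c))).
  move=> z tz; apply: prod_subr_neq0 => c /off ntc.
  by apply/negP => /eqP zc; apply: ntc; rewrite -zc.
rewrite (_ : (fun z => _) = horner (\prod_(c <- rs) ('X - c%:P))).
  exact: path_continuous_horner.
by apply/funext => z; rewrite horner_prod; apply: eq_bigr => c _; rewrite !hornerE.
Qed.

(** Induction on the number of poles: distinct poles are separated, until only
    powers of a single simple fraction remain. A pole of order one contributes 0 by
    hypothesis, and higher orders have a primitive. *)
Lemma contour_integral_frac0 p rs : off_trace rs ->
  (forall c, c \in rs -> pole_integral c = 0) ->
  CI (fun z => p.[z] / \prod_(c <- rs) (z - c)) = 0.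
Proof.
have [n] := ubnP (size rs); elim: n p rs => // n IH p [|c rs] /= sz off P0.
  rewrite -[RHS](contour_integral_horner p).
  by apply: eq_contour_integral => z _; rewrite big_nil divr1.
have offr : off_trace rs by move=> x xr; apply: off; rewrite inE xr orbT.
have P0r x : x \in rs -> pole_integral x = 0 by move=> xr; apply: P0; rewrite inE xr orbT.
have ne z x : trace a b g z -> x \in c :: rs -> z - x != 0.
  move=> tz xr; rewrite subr_eq0; apply/negP => /eqP zx.
  by apply: (off _ xr); rewrite -zx.
have nec z : trace a b g z -> z - c != 0 by move=> tz; apply: ne => //; rewrite mem_head.
(* The numerator reduces to its value at the first pole. *)
have [q Eq] : exists q, p = q * ('X - c%:P) + p.[c]%:P.
  have /factor_theorem[q Eq] : root (p - p.[c]%:P) c.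
    by rewrite rootE !hornerE subrr.
  by exists q; rewrite -Eq subrK.
rewrite (@eq_contour_integral _ (fun z => q.[z] / \prod_(x <- rs) (z - x) +
    p.[c] * (1%:P.[z] / \prod_(x <- c :: rs) (z - x)))); last first.
  move=> z tz; rewrite {1}Eq !big_cons hornerD hornerM hornerXsubC !hornerC.
  have n3 : \prod_(x <- rs) (z - x) != 0.
    by rewrite prodf_seq_neq0; apply/allP => x xr; apply: ne; rewrite // inE xr orbT.
  by field; rewrite n3 nec.
have ifr r u : off_trace r -> path_continuous (fun z => u.[z] / \prod_(x <- r) (z - x)).
  exact: path_continuous_frac.
rewrite contour_integralD; first last.
- by apply: path_continuousM; [exact: path_continuous_cst|exact: ifr].
- exact: ifr.
rewrite contour_integralZ; last exact: ifr.
rewrite IH // add0r; apply/eqP; rewrite mulf_eq0; apply/orP; right; apply/eqP.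
have [/allP/= Hall|] := boolP (all (pred1 c) rs).
  have Er z : \prod_(x <- c :: rs) (z - x) = (z - c) ^+ (size rs).+1.
    rewrite big_cons exprS; congr (_ * _).
    rewrite (eq_big_seq (fun=> z - c)) ?big_const_seq ?count_predT ?iter_mulr_1 //.
    by move=> x /Hall/eqP->.
  rewrite (@eq_contour_integral _ (fun z => (z - c)^-1 ^+ (size rs).+1)).
    have ntc : ~ trace a b g c by apply: off; rewrite mem_head.
    case: (size rs) => [|k]; last exact: contour_integral_pole.
    by rewrite -[RHS](P0 c (mem_head _ _)); apply: eq_contour_integral.
  by move=> z _; rewrite Er hornerC mul1r exprVn.
(* Two distinct poles are separated by partial fractions. *)
move=> /allPn[d dr /= dc].
have cd0 : c - d != 0 by rewrite subr_eq0 eq_sym.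
pose rs' := rem d rs; have prs : perm_eq rs (d :: rs') by exact: perm_to_rem.
have srs' : {subset rs' <= c :: rs}.
  by move=> x /mem_rem xr; rewrite inE xr orbT.
have sub1 : {subset c :: rs' <= c :: rs}.
  by move=> x; rewrite inE => /orP[/eqP->|/srs' //]; rewrite inE eqxx.
have sub2 : {subset d :: rs' <= c :: rs}.
  by move=> x; rewrite inE => /orP[/eqP->|/srs' //]; rewrite inE dr orbT.
have o1 : off_trace (c :: rs') by move=> x /sub1; exact: off.
have o2 : off_trace (d :: rs') by move=> x /sub2; exact: off.
rewrite (@eq_contour_integral _ (fun z =>
    (c - d)^-1 * (1%:P.[z] / \prod_(x <- c :: rs') (z - x)) +
    - (c - d)^-1 * (1%:P.[z] / \prod_(x <- d :: rs') (z - x)))); last first.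
  move=> z tz; rewrite big_cons (perm_big _ prs) !big_cons !hornerC /=.
  have n1 := nec _ tz; have n2 : z - d != 0 by apply: ne => //; rewrite inE dr orbT.
  have n3 : \prod_(x <- rs') (z - x) != 0.
    by rewrite prodf_seq_neq0; apply/allP => x /srs' xr; exact: ne.
  move: (\prod_(x <- rs') _) n3 => Q n3.
  by field; rewrite n1 n2 n3 cd0.
have szr : (size rs').+1 = size rs by rewrite size_rem // prednK //; case: (rs) dr.
rewrite contour_integralD; first last.
- by apply: path_continuousM; [exact: path_continuous_cst|exact: ifr].
- by apply: path_continuousM; [exact: path_continuous_cst|exact: ifr].
rewrite !contour_integralZ; [|exact: ifr..].
rewrite !IH ?mulr0 ?addr0 //=; try by rewrite -ltnS -[(size _).+1]/(size rs').+1 szr.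
- by move=> x /sub2; exact: P0.
- by move=> x /sub1; exact: P0.
Qed.

(** The residue theorem for a rational function whose poles with nonzero winding
    number are among the simple poles lam i. *)
Theorem residue_formula m (lam : 'I_m -> R[i]) (d p : {poly R[i]}) :
  d != 0 -> injective lam ->
  (forall i, root d (lam i)) -> (forall i, d^`().[lam i] != 0) ->
  (forall z, root d z -> ~ trace a b g z) ->
  (forall z, root d z -> (forall i, z <> lam i) -> pole_integral z = 0) ->
  CI (fun z => p.[z] / d.[z]) =
  \sum_(i < m) p.[lam i] / d^`().[lam i] * pole_integral (lam i).
Proof.
move=> d0 il rd sd off out.
have [q [r [Eq qlam pf]]] := partial_fractions p il rd sd.
have q0 : q != 0 by apply: contraNneq d0 => q0; rewrite Eq q0 mulr0.
have [rs Ers] := closed_field_poly_normal q.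
have lq0 : lead_coef q != 0 by rewrite lead_coef_eq0.
have rq c : c \in rs -> root q c.
  by move=> crs; rewrite Ers rootZ // root_prod_XsubC.
have rdq c : c \in rs -> root d c by move=> /rq qc; rewrite Eq rootM qc orbT.
have offrs : off_trace rs by move=> c /rdq; exact: off.
have out0 c : c \in rs -> pole_integral c = 0.
  move=> crs; apply: out; first exact: rdq.
  by move=> i ci; have := qlam i; rewrite -ci rq.
pose r' := (lead_coef q)^-1 *: r.
have qE z : q.[z] = lead_coef q * \prod_(c <- rs) (z - c).
  rewrite {1}Ers hornerZ horner_prod; congr (_ * _).
  by apply: eq_bigr => c _; rewrite hornerXsubC.
rewrite (@eq_contour_integral _ (fun z => r'.[z] / \prod_(c <- rs) (z - c) +
    \sum_(i < m) p.[lam i] / d^`().[lam i] * (z - lam i)^-1)); last first.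
  move=> z tz; rewrite pf; last by apply/negP => dz; apply: off tz; rewrite rootE.
  by rewrite qE hornerZ invfM mulrA [_ * r.[z]]mulrC.
have il' i : path_continuous (fun z => (z - lam i)^-1).
  by apply: path_continuous_off => //; apply: off.
have it i : path_continuous (fun z => p.[lam i] / d^`().[lam i] * (z - lam i)^-1).
  by apply: path_continuousM; [exact: path_continuous_cst|exact: il'].
rewrite contour_integralD; first last.
- exact: path_continuous_sum.
- exact: path_continuous_frac.
rewrite contour_integral_frac0 // add0r.
rewrite contour_integral_sum //; apply: eq_bigr => i _.
by rewrite contour_integralZ.
Qed.

(** * The moments of a matrix polynomial *)

Variables (n l m : nat) (A : 'I_l.+1 -> 'M[R[i]]_n) (u v : 'cV[R[i]]_n).
Variable lam : 'I_m -> R[i].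
Hypotheses (lam_inj : injective lam) (d0 : mpdet A != 0).
Hypothesis rlam : forall i, root (mpdet A) (lam i).
Hypothesis slam : forall i, (mpdet A)^`().[lam i] != 0.
Hypothesis off : forall z, root (mpdet A) z -> ~ trace a b g z.
Hypothesis out : forall z, root (mpdet A) z -> (forall i, z <> lam i) ->
  pole_integral z = 0.

(** Column i is the residue of P(z)^-1 v at lam i, times the winding number of
    the contour about lam i. *)
Definition residue_mx : 'M[R[i]]_(n, m) := \matrix_(r, i)
  ((twopii R)^-1 * ((resolvent_num A v r ord0).[lam i] / (mpdet A)^`().[lam i] *
    pole_integral (lam i))).

Lemma residue_mxE r i : residue_mx r i =
  (twopii R)^-1 * ((resolvent_num A v r ord0).[lam i] / (mpdet A)^`().[lam i] *
    pole_integral (lam i)).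
Proof. by rewrite mxE. Qed.

Lemma s_moment_residue r k :
  s_moment a b g A v k r ord0 = \sum_(i < m) residue_mx r i * lam i ^+ k.
Proof.
rewrite mxE.
rewrite (@eq_contour_integral _
  (fun z => ('X^k * resolvent_num A v r ord0).[z] / (mpdet A).[z])); last first.
  move=> z tz; rewrite hornerM hornerXn resolvent_numE ?mulrA //.
  by apply/negP => dz; apply: off tz; rewrite rootE.
rewrite (residue_formula _ d0 lam_inj rlam slam off out) mulr_sumr.
by apply: eq_bigr => i _; rewrite residue_mxE hornerM hornerXn; ring.
Qed.

Lemma mu_moment_residue k : mu_moment a b g A u v k =
  \sum_(i < m) (\sum_r conjc (u r ord0) * residue_mx r i) * lam i ^+ k.
Proof.
pose N := \sum_r (conjc (u r ord0))%:P * resolvent_num A v r ord0.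
rewrite /mu_moment (@eq_contour_integral _
  (fun z => ('X^k * N).[z] / (mpdet A).[z])); last first.
  move=> z tz; rewrite hornerM hornerXn -mulrA; congr (_ * _).
  rewrite -mulmxA mxE horner_sum mulr_suml; apply: eq_bigr => r _.
  rewrite resolvent_numE ?mxE ?hornerM ?hornerC ?mulrA //.
  by apply/negP => dz; apply: off tz; rewrite rootE.
rewrite (residue_formula _ d0 lam_inj rlam slam off out) mulr_sumr.
apply: eq_bigr => i _; rewrite hornerM hornerXn horner_sum.
rewrite mulr_sumr !mulr_suml mulr_sumr; apply: eq_bigr => r _.
by rewrite residue_mxE hornerM hornerC; ring.
Qed.

Lemma residue_mx_null i : mpeval A (lam i) *m col i residue_mx = 0.
Proof.
have -> : col i residue_mx =
    ((twopii R)^-1 * ((mpdet A)^`().[lam i]^-1 * pole_integral (lam i))) *: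
    map_mx (horner_eval (lam i)) (resolvent_num A v).
  apply/colP => r; rewrite mxE residue_mxE [RHS]mxE [X in _ = _ * X]mxE.
  by rewrite /horner_eval; ring.
by rewrite -scalemxAr mpeval_resolvent_num // scaler0.
Qed.

Let V := Vandermonde m (\row_i lam i).
Let delta i := \sum_r conjc (u r ord0) * residue_mx r i.

Lemma smatrix_residue : smatrix a b g A v m = residue_mx *m V^T.
Proof.
apply/matrixP => r j; rewrite mxE s_moment_residue mxE.
by apply: eq_bigr => i _; rewrite !mxE.
Qed.

Lemma hankel0_factor : hankel a b g A u v 0 m = V *m diag delta *m V^T.
Proof.
apply/matrixP => i j; rewrite mxE mu_moment_residue mxE addn0.
apply: eq_bigr => k _; rewrite /diag mul_mx_diag !mxE exprD.
by rewrite mulrA [_ * lam k ^+ i]mulrC.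
Qed.

Lemma hankel1_factor : hankel a b g A u v 1 m = V *m diag delta *m diag lam *m V^T.
Proof.
apply/matrixP => i j; rewrite mxE mu_moment_residue mxE.
apply: eq_bigr => k _; rewrite /diag !mul_mx_diag !mxE !exprD expr1.
rewrite -/(delta k); ring.
Qed.

End ContourIntegral.

(** * The invariant pair of the moments *)

Theorem corollary1 (R : realType) (n l m : nat)
  (A : 'I_l.+1 -> 'M[R[i]]_n) (hA : A ord_max != 0) (hreg : mpregular A)
  (a b : R) (g : R -> R[i]) (hg : closed_contour a b g)
  (hGamma : forall z, trace a b g z -> ~ mpeigenvalue A z)
  (u v : 'cV[R[i]]_n) (hv : v != 0)
  (hm : (0 < m)%N) (lam : 'I_m -> R[i])
  (hlam : forall z, (contour_interior a b g z /\ mpeigenvalue A z) <->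
                    exists i, z = lam i)
  (w : 'I_m -> 'cV[R[i]]_m)
  (H0 := hankel a b g A u v 0 m) (H1 := hankel a b g A u v 1 m)
  (hpencil : forall i, mpeigenpair (pencil H1 H0) (lam i) (w i))
  (hdistinct : injective lam)
  (hsimple : forall i, simple_eigenvalue A (lam i) /\
                       simple_eigenvalue (pencil H1 H0) (lam i))
  (hnondeg : forall i, nondegenerate_eigenvalue A (lam i) /\
                       nondegenerate_eigenvalue (pencil H1 H0) (lam i))
  (S := smatrix a b g A v m) (C := invmx H0 *m H1) :
  mppair A S C = 0 /\ simple_invariant_pair A S C.
Proof.
case: hg => ab gab crg cig [s [ps bE pieces]]; subst b.
have cg : ccont `[a, last a s] g by split.
have C1g : on_pieces (fun x y => C1_on x y (re g) /\ C1_on x y (im g)) a s.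
  exact: on_pieces_nth.
have [mlam alam] : (forall i, mpeigenvalue A (lam i)) /\
    (forall i, alg_mult A (lam i) = 1%N).
  by split=> i; have [[]] := hsimple i.
have rlam i : root (mpdet A) (lam i) by have [] := mup1_simple (alam i).
have slam i : (mpdet A)^`().[lam i] != 0 by have [] := mup1_simple (alam i).
have off z : root (mpdet A) z -> ~ trace a (last a s) g z.
  by move=> rz tz; apply: hGamma tz _; apply/mpeigenvalue_root.
have out z : root (mpdet A) z -> (forall i, z <> lam i) ->
    pole_integral a s g z = 0.
  move=> rz zl; apply: (pole_integral_outside ps cg gab C1g) => [|iz].
    exact: off.
  have [i zi] : exists i, z = lam i by apply/hlam; split => //; apply/mpeigenvalue_root.
  exact: zl zi.
pose X := residue_mx a s g A v lam.
pose V := Vandermonde m (\row_i lam i).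
pose delta i := \sum_r conjc (u r ord0) * X r i.
have Vu : V \in unitmx by exact: Vandermonde_unit.
have VTu : V^T \in unitmx by rewrite unitmx_tr.
have SE : S = X *m V^T by exact: smatrix_residue.
have H0E : H0 = V *m diag delta *m V^T by exact: hankel0_factor.
have H1E : H1 = V *m diag delta *m diag lam *m V^T by exact: hankel1_factor.
have delta0 i : delta i != 0.
  apply: (@pencil_diag_neq0 _ _ V V^T delta lam); rewrite -H0E -H1E.
  (* The zero polynomial has multiplicity 0 everywhere, so a simple eigenvalue
     forces the pencil to be regular. *)
  have [_ [_ sp]] := hsimple (Ordinal hm).
  by apply: contra_eq_neq sp => E; rewrite /alg_mult E mup0.
have Bu : V *m diag delta \in unitmx.
  rewrite unitmx_mul Vu unitmxE det_diag unitfE prodf_seq_neq0.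
  by apply/allP => i _; rewrite mxE delta0.
have CE : C = invmx V^T *m diag lam *m V^T.
  have H0u : H0 \in unitmx by rewrite H0E unitmx_mul Bu.
  suff H1C : H1 = H0 *m (invmx V^T *m diag lam *m V^T) by rewrite /C H1C mulKmx.
  by rewrite H0E H1E !mulmxA mulmxK.
have X0 i : col i X != 0.
  apply: contraNneq (delta0 i) => /colP Xi; rewrite /delta big1 // => r _.
  by have := Xi r; rewrite !mxE => ->; rewrite mulr0.
have P0 : mppair A S C = 0.
  by rewrite SE CE; apply: mppair_diag => // i; exact: residue_mx_null.
split => //; split.
- split => //.
    apply: contraNneq (X0 (Ordinal hm)) => S0.
    have -> : X = 0 by rewrite -[X](mulmxK VTu) -SE S0 mul0mx.
    by apply/eqP/colP => r; rewrite !mxE.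
  rewrite hm /= -ltnS; apply: leq_trans (size_mpdet A).
  have := max_poly_roots hreg (_ : all (root (mpdet A)) [seq lam i | i <- enum 'I_m]).
  rewrite size_map size_enum_ord; apply.
    by apply/allP => z /mapP[i _ ->].
  by rewrite map_inj_uniq ?enum_uniq.
- by rewrite SE CE; exact: minimal_pair_diag.
- move=> z; rewrite eigenvalue_root_char CE char_poly_diag // => rz.
  have [i ->] : exists i, z = lam i.
    move: rz; rewrite rootE horner_prod prodf_seq_eq0 => /hasP[i _ /=].
    by rewrite hornerXsubC subr_eq0 => /eqP; exists i.
  by rewrite mup_prod_XsubC // alam.
Qed.
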